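(* Let $n\ge 2$. For any $0\le i\le n$ and any $b\in\{0,1\}$, put $i':=n+b+(-1)^{b+1}i$. Then, as maps $\mathcal{M}_n\to\mathcal{M}_{n+1}$, $$\mathcal{I}^{(n)}_{i'}=(F_{n+1})^{-1}\circ I^{(n)}_{i,b}\circ F_n ,$$ where $F_m:\mathcal{M}_m\to\{0,1\}^m$ is the bijection $w_J\mapsto(x_1,\dots,x_m)$ with $x_i=1$ if $i\in J$ and $x_i=0$ otherwise.
   Context: For $m\ge2$ let $\epsilon_1,\dots,\epsilon_m$ be the standard basis of $\mathbb{R}^m$, $\alpha_1:=\epsilon_1$, $\alpha_i:=\epsilon_i-\epsilon_{i-1}$ for $2\le i\le m$, $s_i$ the orthogonal reflection associated with $\alpha_i$, and $W(B_m)$ the group generated by $s_1,\dots,s_m$. $W(B_n)$ is regarded as the subgroup of $W(B_{n+1})$ generated by $s_1,\dots,s_n$. For $J=\{j_1<\dots<j_t\}\subseteq\{1,\dots,m\}$ let $w_J:=w_{j_1}w_{j_2}\cdots w_{j_t}$ (composition of maps, rightmost applied first), where $w_j:=s_js_{j-1}\cdots s_1$ and $w_\emptyset=\mathrm{id}$; let $\mathcal{M}_m:=\{w_J\mid J\subseteq\{1,\dots,m\}\}$. Then $\mathcal{M}_n\subset\mathcal{M}_{n+1}$. Let $W(A_{m-1})$ be the subgroup of $W(B_m)$ generated by $s_2,\dots,s_m$, i.e. the stabilizer of $(1/2,\dots,1/2)$; write $[w]=wW(A_{m-1})$. $\mathcal{M}_m$ is the set of minimal-length representatives of the cosets in $W(B_m)/W(A_{m-1})$,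 and $W(B_m)$ acts on $\mathcal{M}_m$ by $v\cdot w:=$ the minimal-length representative of $[vw]$. Bit insertion: for $0\le i\le n$, $b\in\{0,1\}$, $I^{(n)}_{i,b}(x_1\cdots x_n):=x_1\cdots x_i\,b\,x_{i+1}\cdots x_n$. Elements $\mathcal{I}^{(n)}_j\in W(B_{n+1})$ for $0\le j\le 2n+1$: $\mathcal{I}^{(n)}_0:=\mathrm{id}$; $\mathcal{I}^{(n)}_j:=s_{n+2-j}\cdots s_ns_{n+1}$ for $1\le j\le n$; $\mathcal{I}^{(n)}_j:=s_{j-n}\cdots s_2s_1\,\mathcal{I}^{(n)}_n$ for $n+1\le j\le 2n+1$. As a map $\mathcal{M}_n\to\mathcal{M}_{n+1}$, $\mathcal{I}^{(n)}_j$ sends $w\in\mathcal{M}_n\subset\mathcal{M}_{n+1}$ to $\mathcal{I}^{(n)}_j\cdot w$, i.e. to the minimal-length representative of the coset $\mathcal{I}^{(n)}_j w\,W(A_n)$ in $W(B_{n+1})/W(A_n)$. *)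

(* Defs.v *)
From mathcomp Require Import all_boot all_order all_algebra.
From mathcomp Require Import all_classical all_reals.

Set Implicit Arguments.
Unset Strict Implicit.
Unset Printing Implicit Defensive.

Import Order.TTheory GRing.Theory Num.Theory.

Local Open Scope classical_set_scope.
Local Open Scope ring_scope.

(* Linear maps of R^m are square matrices acting on column vectors, so that    *)
(* the matrix product is composition, rightmost factor first.  The arguments   *)
(* of [eps], [alpha], [s] and [w] are the 1-based indices 1, ..., m, whereas a *)
(* subset J of {1, ..., m} is a {set 'I_m} in which k : 'I_m stands for k.+1.  *)

Definition dot (R : realType) (m : nat) (u v : 'cV[R]_m) : R :=
  (u^T *m v) 0 0.

Definition eps (R : realType) (m i : nat) : 'cV[R]_m :=
  \col_(k < m) (k.+1 == i)%:R.

Definition alpha (R : realType) (m i : nat) : 'cV[R]_m :=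
  if i == 1%N then eps R m 1 else eps R m i - eps R m i.-1.

Definition reflmx (R : realType) (m : nat) (a : 'cV[R]_m) : 'M[R]_m :=
  1%:M - (2 / dot a a) *: (a *m a^T).

Lemma reflmxE (R : realType) (m : nat) (a v : 'cV[R]_m) :
  reflmx a *m v = v - (2 * dot a v / dot a a) *: a.
Proof.
rewrite mulmxBl mul1mx -scalemxAl -mulmxA; congr (_ - _).
rewrite [a^T *m v]mx11_scalar mul_mx_scalar scalerA -/(dot a v).
by rewrite -!mulrA [_^-1 * _]mulrC.
Qed.

Definition s (R : realType) (m i : nat) : 'M[R]_m := reflmx (alpha R m i).

(* s_j ... s_2 s_1 *)
Definition w (R : realType) (m j : nat) : 'M[R]_m :=
  \prod_(i <- rev (iota 1 j)) s R m i.

(* [enum J] lists J in increasing order. *)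
Definition wJ (R : realType) (m : nat) (J : {set 'I_m}) : 'M[R]_m :=
  \prod_(j <- enum J) w R m j.+1.

Definition MM (R : realType) (m : nat) : set 'M[R]_m :=
  [set u | exists J : {set 'I_m}, u = wJ R J].
Arguments MM R m : clear implicits.

Definition subgroup (R : realType) (m : nat) (G : set 'M[R]_m) : Prop :=
  [/\ G 1%:M, forall u v, G u -> G v -> G (u *m v)
    & forall u, G u -> G (invmx u)].

(* W(A_{m-1}), a subgroup of W(B_m) *)
Definition WA (R : realType) (m : nat) : set 'M[R]_m :=
  smallest (@subgroup R m) [set u | exists2 i, (2 <= i <= m)%N & u = s R m i].
Arguments WA R m : clear implicits.

Definition cosetA (R : realType) (m : nat) (u : 'M[R]_m) : set 'M[R]_m :=
  [set u *m a | a in WA R m].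

Definition is_word (R : realType) (m k : nat) (u : 'M[R]_m) : bool :=
  [exists t : k.-tuple 'I_m, u == \prod_(i <- t) s R m i.+1].

(* Coxeter length with respect to s_1, ..., s_m; 0 outside of W(B_m) *)
Definition len (R : realType) (m : nat) (u : 'M[R]_m) : nat :=
  if pselect (exists k, is_word k u) is left e then ex_minn e else 0%N.

Definition is_minrep (R : realType) (m : nat) (u v : 'M[R]_m) : Prop :=
  cosetA u v /\ forall v', cosetA u v' -> (len v <= len v')%N.

Definition act (R : realType) (m : nat) (v u : 'M[R]_m) : 'M[R]_m :=
  xget 0 [set v' | is_minrep (v *m u) v'].

(* The inclusion of W(B_n) in W(B_{n+1}): A |-> diag(A, 1) *)
Definition emb (R : realType) (n : nat) (A : 'M[R]_n) : 'M[R]_n.+1 :=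
  \matrix_(i, j)
    match unlift ord_max i, unlift ord_max j with
    | Some i', Some j' => A i' j'
    | None, None => 1
    | _, _ => 0
    end.

(* [w R n.+1 (j - n)] is the prefix s_{j-n} ... s_2 s_1 for j > n. *)
Definition calI (R : realType) (n j : nat) : 'M[R]_n.+1 :=
  let up j := \prod_(n + 2 - j <= k < n + 2) s R n.+1 k in
  if j == 0%N then 1%:M
  else if (j <= n)%N then up j
  else w R n.+1 (j - n) *m up n.

Lemma insert_bit_subproof (n i : nat) (b : bool) (x : n.-tuple bool) :
  size (take i x ++ b :: drop i x) == n.+1.
Proof. by rewrite size_cat /= addnS -size_cat cat_take_drop size_tuple. Qed.

Definition insert_bit (n i : nat) (b : bool) (x : n.-tuple bool) :
  n.+1.-tuple bool := Tuple (insert_bit_subproof i b x).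

Definition bits (m : nat) (J : {set 'I_m}) : m.-tuple bool :=
  [tuple i \in J | i < m].

(* The J with u = w_J is unique by [wJ_inj], hence [F_wJ] and [F_bij]. *)
Definition F (R : realType) (m : nat) (u : 'M[R]_m) : m.-tuple bool :=
  bits (xget finset.set0 [set J | u = wJ R J]).

Definition Finv (R : realType) (m : nat) : m.-tuple bool -> 'M[R]_m :=
  'pinv_(fun=> 0) (MM R m) (@F R m).

Lemma epsE (R : realType) (m : nat) (k : 'I_m) : eps R m k.+1 = delta_mx k 0.
Proof. by apply/colP => i; rewrite !mxE eqSS eqxx andbT. Qed.

Lemma dotBl (R : realType) (m : nat) (u v x : 'cV[R]_m) :
  dot (u - v) x = dot u x - dot v x.
Proof. by rewrite /dot linearB /= mulmxBl !mxE. Qed.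

Lemma dot_eps (R : realType) (m : nat) (k : 'I_m) (v : 'cV[R]_m) :
  dot (eps R m k.+1) v = v k 0.
Proof. by rewrite /dot epsE trmx_delta -rowE mxE. Qed.

Lemma s1E (R : realType) (m : nat) (v : 'cV[R]_m) (z k : 'I_m) :
  z = 0%N :> nat -> (s R m 1 *m v) k 0 = if k == z then - v z 0 else v k 0.
Proof.
move=> z0; rewrite /s /alpha eqxx -[1%N]/(0.+1) -[in eps _ _ _]z0.
rewrite reflmxE !dot_eps epsE !mxE !eqxx andbT /= divr1.
case: eqP => [->|_]; last by rewrite mulr0 subr0.
by rewrite mulr1 mulr_natl mulr2n opprD addrA subrr add0r.
Qed.

Lemma sSE (R : realType) (m : nat) (v : 'cV[R]_m) (p q k : 'I_m) :
  q = p.+1 :> nat ->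
  (s R m q.+1 *m v) k 0 =
  if k == p then v q 0 else if k == q then v p 0 else v k 0.
Proof.
move=> qp.
have npq : (p == q) = false by apply/eqP => e; move: qp; rewrite e => /n_Sn.
have nqp : (q == p) = false by rewrite eq_sym.
have -> : s R m q.+1 = reflmx (eps R m q.+1 - eps R m p.+1).
  by rewrite /s /alpha eqSS qp.
have d2 : dot (eps R m q.+1 - eps R m p.+1) (eps R m q.+1 - eps R m p.+1) = 2.
  by rewrite dotBl !dot_eps !epsE !mxE !eqxx npq nqp /= subr0 sub0r opprK.
rewrite reflmxE d2 dotBl !dot_eps [2 * _]mulrC mulfK ?pnatr_eq0//.
rewrite !epsE !mxE !eqxx !andbT.
case: (eqVneq k p) => [->|kp]; first by rewrite npq sub0r mulrN1 opprK addrC subrK.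
case: (eqVneq k q) => [->|kq]; first by rewrite subr0 mulr1 opprB addrC subrK.
by rewrite subrr mulr0 subr0.
Qed.

Lemma wE (R : realType) (m : nat) (v : 'cV[R]_m.+1) (j k : 'I_m.+1) :
  (w R m.+1 j.+1 *m v) k 0 =
  if (k < j)%N then v (inord k.+1) 0
  else if k == j then - v 0 0 else v k 0.
Proof.
case: j => j jm; elim: j jm k => [|j IH] jm k.
  rewrite /w /= /rev /= big_seq1 (@s1E _ _ _ ord0)//.
have jm' := ltnW jm.
have -> : w R m.+1 j.+2 = s R m.+1 j.+2 *m w R m.+1 j.+1.
  by rewrite /w -[in LHS](addn1 j.+1) iotaD rev_cat /= big_cons add1n.
rewrite -mulmxA.
rewrite (@sSE _ _ _ (Ordinal jm') (Ordinal jm))//= !(IH jm') /=.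
rewrite -!(inj_eq val_inj) /= ltnS.
case: (ltngtP k j) => [kj|jk|kj] /=.
- by rewrite (ltn_eqF (ltn_trans kj (ltnSn _))).
- rewrite ltnn eqxx; case: eqP => // _.
- rewrite ltnNge leqnSn /= gtn_eqF//.
  by congr (v _ 0); apply/val_inj; rewrite /= inordK kj.
Qed.

Lemma wJ_ones (R : realType) (m : nat) (J : {set 'I_m}) :
  wJ R J *m const_mx 1 = \col_k (-1) ^+ (k \in J) :> 'cV[R]_m.
Proof.
case: m J => [|m] J; first by apply/colP => -[].
have -> : \col_k (-1) ^+ (k \in J) = \col_k (-1) ^+ (k \in enum J) :> 'cV[R]_m.+1.
  by apply/colP => k; rewrite !mxE mem_enum.
rewrite /wJ; have : sorted ltn (map val (enum J)).
  have -> : enum J = [seq x <- enum 'I_m.+1 | x \in J].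
    by rewrite enumT {1}/enum_mem.
  rewrite sorted_map sorted_filter//; first by move=> x y z; apply: ltn_trans.
  by rewrite -sorted_map val_enum_ord iota_ltn_sorted.
elim: (enum J) => [_|j l IH /= jl].
  by rewrite big_nil mul1mx; apply/colP => k; rewrite !mxE.
rewrite big_cons -mulmxA IH ?(path_sorted jl)//.
have jl' x : x \in l -> (j < x)%N.
  by move=> xl; apply: (allP (order_path_min ltn_trans jl)); rewrite map_f.
have nl (x : 'I_m.+1) : (x <= j)%N -> (x \in l) = false.
  by move=> xj; apply/negP => /jl'; rewrite ltnNge xj.
apply/colP => k; rewrite wE !mxE inE -(inj_eq val_inj) /=.
case: ltngtP => kj /=.
- by rewrite !nl// ?inordK ?(ltnW kj)//; apply: leq_trans (ltn_ord j).
- by [].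
- by rewrite nl.
Qed.

Lemma wJ_inj (R : realType) (m : nat) : injective (@wJ R m).
Proof.
move=> J K JK; apply/setP => k.
have := congr1 (fun u : 'M[R]_m => (u *m const_mx 1 : 'cV_m) k 0) JK.
rewrite !wJ_ones !mxE.
have ne : (-1 == 1 :> R) = false.
  by apply/eqP => e; have := ltrN10 R; rewrite e ltr10.
by case: (k \in J); case: (k \in K) => //= /eqP; rewrite ?ne// eq_sym ne.
Qed.

Lemma F_wJ (R : realType) (m : nat) (J : {set 'I_m}) : F (wJ R J) = bits J.
Proof.
rewrite /F; congr bits; apply: xget_unique => // K /= /wJ_inj ->//.
Qed.

Lemma F_bij (R : realType) (m : nat) : set_bij (MM R m) setT (@F R m).
Proof.
split=> // [_ _ /set_mem[J ->] /set_mem[K ->]|x _].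
  rewrite !F_wJ => JK; congr wJ; apply/setP => k.
  by have := congr1 (fun x : m.-tuple bool => tnth x k) JK; rewrite !tnth_mktuple.
exists (wJ R [set k | tnth x k]%SET); first by exists [set k | tnth x k]%SET.
by rewrite F_wJ; apply/eq_from_tnth => k; rewrite tnth_mktuple inE.
Qed.

Lemma embM (R : realType) (n : nat) (A B : 'M[R]_n) :
  emb (A *m B) = emb A *m emb B.
Proof.
apply/matrixP => i j; rewrite !mxE (bigD1_ord ord_max)//= !mxE unlift_none.
under eq_bigr do rewrite !mxE liftK.
case: (unlift ord_max i) => [i'|]; case: (unlift ord_max j) => [j'|];
  rewrite ?mxE ?(mul0r, mulr0, mul1r, add0r, addr0)//.
all: by rewrite big1 ?addr0// => k _; rewrite ?mul0r ?mulr0.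
Qed.

Lemma emb_s (R : realType) (n i : nat) : (1 <= i <= n)%N ->
  emb (s R n i) = s R n.+1 i.
Proof.
move=> /andP[i1 lin].
have alift k : alpha R n.+1 i (lift ord_max k) 0 = alpha R n i k 0.
  by rewrite /alpha; case: ifP => _; rewrite !mxE lift_max.
have amax : alpha R n.+1 i ord_max 0 = 0.
  rewrite /alpha; case: ifP => i1'; rewrite !mxE /= ?eqSS.
    by move: lin; rewrite (eqP i1'); case: n {alift}.
  rewrite gtn_eqF// gtn_eqF ?subr0//.
  by rewrite ltnS (leq_trans (leq_pred _)).
have adot : dot (alpha R n.+1 i) (alpha R n.+1 i) =
            dot (alpha R n i) (alpha R n i).
  rewrite /dot !mxE (bigD1_ord ord_max)//= amax mulr0 add0r.
  by apply: eq_bigr => k _; rewrite !mxE alift.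
apply/matrixP => p q; rewrite !mxE !big_ord1 !mxE adot.
case: unliftP => [p'|] ->; case: unliftP => [q'|] ->.
- by rewrite !mxE !big_ord1 !mxE !alift (inj_eq lift_inj).
- by rewrite amax alift !mulr0 subr0 eq_sym (negPf (neq_lift _ _)).
- by rewrite amax mul0r mulr0 subr0 (negPf (neq_lift _ _)).
- by rewrite amax eqxx !mulr0 subr0.
Qed.

(* Main.v *)
(** By induction on the word, every word of length k in s_1, ..., s_m equals
    w_J v, where v is a word in s_2, ..., s_m and the lengths of w_J (the sum of
    the elements of J) and v add up to at most k: left multiplication by s_i
    either sends w_J to some w_K whose length exceeds that of w_J by at most
    one, or can be moved across w_J, becoming some s_q with q >= 2.  The vector
    (1, ..., 1) is fixed by W(A_{m-1}), and w_J sends it to the sign vector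
    of J, so J is determined by the coset and w_J is its unique shortest
    element.  It then suffices to compare the images of (1, ..., 1):
    s_{i+2} ... s_{n+1} moves the last coordinate, which is 1, to position i+1,
    and for b = 1 the factor w_{i+1} moves a 1 from the first position to
    position i+1 while changing its sign. *)

Require Import Defs.
From mathcomp Require Import all_boot all_order all_algebra.
From mathcomp Require Import all_classical all_reals.
From mathcomp Require Import zify.

Set Implicit Arguments.
Unset Strict Implicit.
Unset Printing Implicit Defensive.

Import Order.TTheory GRing.Theory Num.Theory.

Local Open Scope ring_scope.

Ltac index_cases :=
  repeat match goal with
  | |- context [if ?b then _ else _] =>
      lazymatch b with context [if _ then _ else _] => fail | _ => idtac end;
      let h := fresh in case h : b; try (exfalso; lia)
  end;
  try done; try (congr (_ _); lia); try (congr (- _ _); lia).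

(** * Generators acting on coordinates, and their relations *)

Section Words.
Context {R : realType}.
Implicit Type m : nat.

(* Indices from here on are 0-based: [w R m k.+1] acts on coordinates 0, ..., k. *)
Definition colf m (f : nat -> R) : 'cV[R]_m := \col_k f k.

(** Functions on [nat] include the indicators of single coordinates, so relations between generators
    reduce to comparing indices in [nat]. *)
Lemma mulmx_col_ext m (A B : 'M[R]_m) :
  (forall f : nat -> R, A *m colf m f = B *m colf m f) ->
  A = B.
Proof.
move=> AB; apply/matrixP => p q.
have e : \col_(k < m) (k == q :> nat)%:R = delta_mx q 0 :> 'cV[R]_m.
  by apply/colP => k; rewrite !mxE andbT.
have := AB (fun k => (k == q :> nat)%:R); rewrite /colf e -!colE => /colP/(_ p).
by rewrite !mxE.
Qed.

Lemma s_col m (p : nat) (f : nat -> R) : (p.+1 < m)%N ->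
  s R m p.+2 *m colf m f =
  colf m (fun k => if k == p then f p.+1 else if k == p.+1 then f p else f k).
Proof.
move=> pm; apply/colP => k.
by rewrite (@sSE _ _ _ (Ordinal (ltnW pm)) (Ordinal pm)) ?mxE -?val_eqE.
Qed.

Lemma w_col m (j : nat) (f : nat -> R) : (j < m)%N ->
  w R m j.+1 *m colf m f =
  colf m (fun k => if (k < j)%N then f k.+1
                   else if k == j then - f 0%N else f k).
Proof.
case: m => // m jm; apply/colP => k.
rewrite -[j.+1]/((Ordinal jm).+1) wE ?mxE /= -?val_eqE /=.
by case: ltnP => // kj; rewrite inordK // (leq_ltn_trans kj).
Qed.

Lemma wS m j : w R m j.+1 = s R m j.+1 *m w R m j.
Proof. by rewrite /w -[in LHS](addn1 j) iotaD rev_cat /= big_cons add1n. Qed.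

Lemma w1 m : w R m 1 = s R m 1.
Proof. by rewrite /w /= /rev /= big_seq1. Qed.

Lemma sK m p : (p < m)%N -> s R m p.+1 *m s R m p.+1 = 1%:M.
Proof.
move=> pm; apply: mulmx_col_ext => f; rewrite -mulmxA mul1mx.
case: p pm => [|p] pm.
  rewrite -w1 !w_col//; apply/colP => -[k km]; rewrite !mxE /=.
  by case: k km => [|k] km; rewrite /= ?opprK.
rewrite !s_col//; apply/colP => -[k km]; rewrite !mxE /=; index_cases.
Qed.

(** The two factors act on disjoint sets of coordinates: p, p+1 and 0, ..., j. *)
Lemma s_w_comm m p j : (j < p)%N -> (p.+1 < m)%N ->
  s R m p.+2 *m w R m j.+1 = w R m j.+1 *m s R m p.+2.
Proof.
move=> jp pm; apply: mulmx_col_ext => f; rewrite -!mulmxA.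
rewrite w_col ?s_col ?w_col//; try lia.
apply/colP => -[k km]; rewrite !mxE /=; index_cases.
Qed.

(** [w R m j.+1] carries coordinates p+1, p+2 to positions p, p+1 without a sign; only position j
    receives one. *)
Lemma s_w_shift m p j : (p.+1 < j)%N -> (j < m)%N ->
  s R m p.+2 *m w R m j.+1 = w R m j.+1 *m s R m p.+3.
Proof.
move=> jp pm; apply: mulmx_col_ext => f; rewrite -!mulmxA.
rewrite w_col ?s_col ?w_col//; try lia.
apply/colP => -[k km]; rewrite !mxE /=; index_cases.
Qed.

(** The product of the two [w] brings coordinates 1 and 0, both negated, to positions j and j+1, so
    exchanging these positions amounts to exchanging coordinates 0 and 1 first. *)
Lemma s_w_w m j : (j.+1 < m)%N ->
  s R m j.+2 *m (w R m j.+1 *m w R m j.+2) =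
  w R m j.+1 *m w R m j.+2 *m s R m 2.
Proof.
move=> jm; rewrite mulmxA -wS; apply: mulmx_col_ext => f; rewrite -!mulmxA.
rewrite (@s_col m 0)  ?w_col//; try lia.
apply/colP => -[k km]; rewrite !mxE /=; index_cases.
Qed.

(** * Left multiplication of w_J by a generator *)

(* The factors of [wJ] with 0-based index in [a, b), for the subset of
   characteristic function [x]. *)
Definition wbits m (a b : nat) (x : nat -> bool) : 'M[R]_m :=
  \prod_(a <= k < b) w R m k.+1 ^+ x k.

(* The number of letters in [wbits m a b x]. *)
Definition lbits (a b : nat) (x : nat -> bool) : nat :=
  (\sum_(a <= k < b) x k * k.+1)%N.

Lemma wbits_ltn m a b x : (a < b)%N ->
  wbits m a b x = w R m a.+1 ^+ x a *m wbits m a.+1 b x.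
Proof. by move=> ab; rewrite /wbits big_ltn. Qed.

Lemma lbits_ltn a b x : (a < b)%N ->
  lbits a b x = (x a * a.+1 + lbits a.+1 b x)%N.
Proof. by move=> ab; rewrite /lbits big_ltn. Qed.

Lemma wbits_cat m c a b x : (a <= c <= b)%N ->
  wbits m a b x = wbits m a c x *m wbits m c b x.
Proof. by case/andP => ac cb; rewrite /wbits (big_cat_nat ac cb). Qed.

Lemma eq_wbits m a b x y : (forall k, (a <= k < b)%N -> x k = y k) ->
  wbits m a b x = wbits m a b y.
Proof. by move=> xy; apply: eq_big_nat => k /xy ->. Qed.

Lemma eq_lbits a b x y : (forall k, (a <= k < b)%N -> x k = y k) ->
  lbits a b x = lbits a b y.
Proof. by move=> xy; apply: eq_big_nat => k /xy ->. Qed.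

Lemma s_wbits_comm m p b x : (b <= p)%N -> (p.+1 < m)%N ->
  s R m p.+2 *m wbits m 0 b x = wbits m 0 b x *m s R m p.+2.
Proof.
move=> + pm; elim: b => [|b IH] bp.
  by rewrite /wbits big_geq// mulmx1 mul1mx.
rewrite (@wbits_cat m b) ?leqnSn// mulmxA IH ?(ltnW bp)// -!mulmxA; congr (_ *m _).
rewrite /wbits big_nat1; case: (x b); last by rewrite expr0 mulmx1 mul1mx.
by rewrite expr1 s_w_comm.
Qed.

(** Crossing a factor raises p by at most one while a rises by one, so the condition p+1 < a
    survives. *)
Lemma s_wbits_shift m p a b x : (p.+1 < a)%N -> (b <= m)%N -> (p.+1 < m)%N ->
  exists2 q, (0 < q < m)%N &
    s R m p.+2 *m wbits m a b x = wbits m a b x *m s R m q.+1.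
Proof.
move=> + bm; have [d] := ubnP (b - a); elim: d p a => // d IH p a dab pa pm.
have [ba|ab] := leqP b a.
  by exists p.+1 => //; rewrite /wbits big_geq// mulmx1 mul1mx.
rewrite wbits_ltn// mulmxA; case: (x a); last first.
  have [||//|q qm e] := IH p a.+1; try lia.
  by exists q => //; rewrite expr0 mulmx1 mul1mx.
have [|||q qm e] := IH p.+1 a.+1; try lia.
by exists q => //; rewrite expr1 s_w_shift ?(leq_trans ab)// -!mulmxA e.
Qed.

(** Since s_1 = w_1, it toggles bit 0. For [s R m p.+2] only bits p and p+1 matter: if they differ,
    [wS] exchanges them; if they agree, the reflection crosses the whole product. *)
Lemma s_wbits m i x : (i < m)%N ->
  (exists2 y, s R m i.+1 *m wbits m 0 m x = wbits m 0 m y &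
     (lbits 0 m y <= (lbits 0 m x).+1)%N) \/
  (exists2 q, (0 < q < m)%N &
     s R m i.+1 *m wbits m 0 m x = wbits m 0 m x *m s R m q.+1).
Proof.
case: i => [|p] pm.
  left; pose y k := if k == 0%N then ~~ x 0%N else x k.
  have yx k : (0 < k < m)%N -> y k = x k by case: k.
  exists y; last by rewrite !(lbits_ltn _ pm) (eq_lbits yx) /y /=; lia.
  rewrite !(wbits_ltn _ _ pm) (eq_wbits _ yx) mulmxA /y /= -w1.
  by case: (x 0%N); rewrite /= ?expr1 ?expr0 ?mulmx1 // w1 sK.
have split2 y : wbits m 0 m y = wbits m 0 p y *m
    (w R m p.+1 ^+ y p *m w R m p.+2 ^+ y p.+1 *m wbits m p.+2 m y).
  have pm' : (0 <= p <= m)%N by rewrite /= 2?ltnW.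
  by rewrite (wbits_cat _ _ pm') (wbits_ltn _ _ (ltnW pm)) (wbits_ltn _ _ pm) -mulmxA.
have lsplit2 y : lbits 0 m y = (lbits 0 p y +
    (y p * p.+1 + y p.+1 * p.+2 + lbits p.+2 m y))%N.
  rewrite /lbits (@big_cat_nat _ _ _ p) /=; try lia.
  rewrite -!/(lbits _ _ _) (lbits_ltn _ (ltnW pm)) (lbits_ltn _ pm); lia.
(* The tail is crossed by [s R m p.+2] itself when both bits are 0, and by s_2, coming from [s_w_w],
   when both are 1. *)
have [q qm sB] := s_wbits_shift x (ltnSn p.+1) (leqnn m) pm.
have [r rm s2B] := s_wbits_shift x (ltn0Sn p.+1 : 1 < p.+2)%N (leqnn m)
  (leq_ltn_trans (ltn0Sn p) pm).
pose y k := if k == p then x p.+1 else if k == p.+1 then x p else x k.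
have yl k : (0 <= k < p)%N -> y k = x k by rewrite /y; do !case: eqP; lia.
have yr k : (p.+2 <= k < m)%N -> y k = x k by rewrite /y; do !case: eqP; lia.
have yp : y p = x p.+1 by rewrite /y eqxx.
have yp1 : y p.+1 = x p by rewrite /y eqxx; case: eqP => //; lia.
case xp: (x p); case xp1: (x p.+1).
- right; exists r => //; rewrite split2 mulmxA s_wbits_comm// -!mulmxA.
  congr (_ *m _); rewrite xp xp1 !expr1 [w _ _ _ *m (_ *m wbits _ _ _ _)]mulmxA mulmxA s_w_w//.
  by rewrite -!mulmxA s2B.
- left; exists y; last by rewrite !lsplit2 (eq_lbits yl) (eq_lbits yr) yp yp1 xp xp1; lia.
  rewrite !split2 (eq_wbits _ yl) (eq_wbits _ yr) yp yp1 xp xp1 mulmxA s_wbits_comm//.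
  rewrite -!mulmxA; congr (_ *m _).
  by rewrite expr1 expr0 !mulmxA mul1mx mulmx1 -wS.
- left; exists y; last by rewrite !lsplit2 (eq_lbits yl) (eq_lbits yr) yp yp1 xp xp1; lia.
  rewrite !split2 (eq_wbits _ yl) (eq_wbits _ yr) yp yp1 xp xp1 mulmxA s_wbits_comm//.
  rewrite -!mulmxA; congr (_ *m _).
  by rewrite expr1 expr0 !mulmxA !mulmx1 [w R m p.+2]wS mulmxA sK// !mul1mx.
right; exists q => //; rewrite split2 mulmxA s_wbits_comm// -!mulmxA.
by congr (_ *m _); rewrite xp xp1 !expr0 !mul1mx.
Qed.

(** * Words, length and the subgroup W(A_{m-1}) *)

Definition sprod m (t : seq 'I_m) : 'M[R]_m := \prod_(i <- t) s R m i.+1.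

Lemma sprod_cons m (i : 'I_m) t : sprod (i :: t) = s R m i.+1 *m sprod t.
Proof. by rewrite /sprod big_cons. Qed.

Lemma sprod_cat m (t1 t2 : seq 'I_m) : sprod (t1 ++ t2) = sprod t1 *m sprod t2.
Proof. by rewrite /sprod big_cat. Qed.

Lemma sprod_rev m (t : seq 'I_m) : sprod t *m sprod (rev t) = 1%:M.
Proof.
elim: t => [|i t IH]; first by rewrite /sprod big_nil mulmx1.
rewrite rev_cons -cats1 sprod_cat sprod_cons mulmxA -(mulmxA (s _ _ _)) IH.
by rewrite mulmx1 /sprod big_seq1 sK.
Qed.

Lemma invmx_sprod m (t : seq 'I_m) : invmx (sprod t) = sprod (rev t).
Proof.
have tV := sprod_rev t; have [tU _] := mulmx1_unit tV.
by rewrite -[LHS]mulmx1 -tV mulKmx.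
Qed.

Lemma is_wordP m k (u : 'M[R]_m) :
  reflect (exists2 t : seq 'I_m, size t = k & u = sprod t) (is_word k u).
Proof.
apply: (iffP existsP) => [[t /eqP ->]|[t <- ->]]; last by exists (in_tuple t).
by exists t => //; rewrite size_tuple.
Qed.

Lemma is_wordM m k l (u v : 'M[R]_m) :
  is_word k u -> is_word l v -> is_word (k + l) (u *m v).
Proof.
move=> /is_wordP[t <- ->] /is_wordP[r <- ->]; apply/is_wordP.
by exists (t ++ r); rewrite ?size_cat ?sprod_cat.
Qed.

Lemma is_word1 m : is_word 0 (1%:M : 'M[R]_m).
Proof. by apply/is_wordP; exists [::] => //; rewrite /sprod big_nil. Qed.

Lemma is_word_s m j : (j < m)%N -> is_word 1 (s R m j.+1).
Proof.
move=> jm; apply/is_wordP; exists [:: Ordinal jm] => //.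
by rewrite /sprod big_seq1.
Qed.

Lemma is_word_w m j : (j <= m)%N -> is_word j (w R m j).
Proof.
elim: j => [|j IH] jm; first by rewrite /w big_nil is_word1.
by rewrite wS; exact: (is_wordM (is_word_s jm) (IH (ltnW jm))).
Qed.

Lemma is_word_wbits m b x : (b <= m)%N -> is_word (lbits 0 b x) (wbits m 0 b x).
Proof.
elim: b => [|b IH] bm; first by rewrite /lbits /wbits !big_geq// is_word1.
rewrite /lbits /wbits !big_nat_recr//= is_wordM ?IH ?(ltnW bm)//.
by case: (x b); rewrite ?mul1n ?expr1 ?is_word_w// mul0n expr0 is_word1.
Qed.

(** Here and in the next lemma, the given word rules out the default value 0 of [len]. *)
Lemma len_min m k (u : 'M[R]_m) : is_word k u -> (len u <= k)%N.
Proof.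
move=> uk; rewrite /len; case: pselect => [e|]; last by case; exists k.
by case: ex_minnP => l _; apply.
Qed.

Lemma is_word_len m k (u : 'M[R]_m) : is_word k u -> is_word (len u) u.
Proof.
move=> uk; rewrite /len; case: pselect => [e|]; last by case; exists k.
by case: ex_minnP.
Qed.

Lemma WA_sprod m (t : seq 'I_m) : all (fun i : 'I_m => 0 < i)%N t ->
  WA R m (sprod t).
Proof.
move=> tpos G [[G1 GM _] sG]; elim: t tpos => [|i t IH] /=.
  by rewrite /sprod big_nil.
case/andP => i0 /IH Gt; rewrite sprod_cons; apply: GM => //; apply: sG.
by exists i.+1; rewrite ?ltnS ?i0 ?ltn_ord.
Qed.

(** Words without s_1 are closed under products and, the generators being involutions, under
    inverses by reversal. *)
Lemma WAP m (u : 'M[R]_m) : WA R m u ->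
  exists2 t : seq 'I_m, all (fun i : 'I_m => 0 < i)%N t & u = sprod t.
Proof.
apply: (@smallest_sub _ _ _
  [set v | exists2 t, all (fun i : 'I_m => 0 < i)%N t & v = sprod t]%classic).
  split=> [|_ _ [t t0 ->] [r r0 ->]|_ [t t0 ->]].
  - by exists [::]; rewrite // /sprod big_nil.
  - by exists (t ++ r); rewrite ?all_cat ?t0// sprod_cat.
  - by exists (rev t); rewrite ?all_rev// invmx_sprod.
move=> _ [[|i]//= /andP[i0 im] ->]; exists [:: Ordinal im].
  by rewrite /= andbT.
by rewrite /sprod big_seq1.
Qed.

(** * Minimal coset representatives *)

Lemma sprod_decomp m (t : seq 'I_m) : exists x r,
  [/\ all (fun i : 'I_m => 0 < i)%N r,
      sprod t = wbits m 0 m x *m sprod r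
    & (lbits 0 m x + size r <= size t)%N].
Proof.
elim: t => [|i t [x [r [r0 tE lxr]]]].
  exists (fun=> false), [::]; split=> //.
    by rewrite /sprod big_nil mulmx1 /wbits big1// => k _; exact: expr0.
  by rewrite /lbits big1.
rewrite sprod_cons tE mulmxA; case: (s_wbits x (ltn_ord i)) => [[y -> lyx]|].
  by exists y, r; split=> //=; lia.
move=> [q /andP[q0 qm] ->]; exists x, (Ordinal qm :: r); split=> /=.
- by rewrite q0.
- by rewrite sprod_cons mulmxA.
- lia.
Qed.

Lemma sprod_ones m (t : seq 'I_m) : all (fun i : 'I_m => 0 < i)%N t ->
  sprod t *m const_mx 1 = const_mx 1 :> 'cV_m.
Proof.
elim: t => [|[[|p] pm] t IH] //=; first by rewrite /sprod big_nil mul1mx.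
move=> /IH {}IH; rewrite sprod_cons -mulmxA IH /=.
have -> : const_mx 1 = colf m (fun=> 1) by apply/colP => k; rewrite !mxE.
by rewrite s_col//; apply/colP => k; rewrite !mxE; do !case: ifP.
Qed.

Lemma wJ_wbits m (x : nat -> bool) :
  wJ R [set k : 'I_m | x k]%SET = wbits m 0 m x.
Proof.
rewrite /wJ /wbits /index_iota subn0 -val_enum_ord big_map.
have -> : enum [set k : 'I_m | x k]%SET = [seq k : 'I_m <- enum 'I_m | x k].
  rewrite enumT {1}/enum_mem; apply: eq_filter => k.
  by rewrite [LHS]inE.
by rewrite big_filter big_mkcond; apply: eq_bigr => k _; case: (x k).
Qed.

(** Extending membership by false beyond m lets one function describe a subset of ['I_n] both in
    rank n and in rank n+1. *)
Definition ord_mem m (J : {set 'I_m}) (k : nat) : bool :=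
  [exists j, (j \in J) && (j == k :> nat)].

Lemma ord_memE m (J : {set 'I_m}) (k : 'I_m) : ord_mem J k = (k \in J).
Proof.
apply/existsP/idP => [[j /andP[jJ /eqP/val_inj <-]]//|kJ].
by exists k; rewrite kJ eqxx.
Qed.

Lemma ord_mem_ge m (J : {set 'I_m}) k : (m <= k)%N -> ord_mem J k = false.
Proof.
by move=> mk; apply/existsP => -[j /andP[_ /eqP jk]]; have := ltn_ord j; lia.
Qed.

Lemma set_ord_mem m (J : {set 'I_m}) : [set k : 'I_m | ord_mem J k]%SET = J.
Proof. by apply/setP => k; rewrite inE ord_memE. Qed.

Lemma wJ_ones_inj m (J K : {set 'I_m}) :
  wJ R J *m const_mx 1 = wJ R K *m const_mx 1 :> 'cV_m -> J = K.
Proof.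
move=> JK; apply/setP => k; have := congr1 (fun v : 'cV_m => v k 0) JK.
by rewrite !wJ_ones !mxE => /signr_inj.
Qed.

(** This reduces the action on cosets to comparing images of (1, ..., 1). *)
Lemma act_wJ m k (v u : 'M[R]_m) (J : {set 'I_m}) : is_word k (v *m u) ->
  v *m u *m const_mx 1 = wJ R J *m const_mx 1 :> 'cV_m ->
  act v u = wJ R J.
Proof.
rewrite /act => /is_wordP[t _ ->] tJ.
have decJ r : sprod r *m const_mx 1 = wJ R J *m const_mx 1 :> 'cV_m ->
    exists r', [/\ all (fun i : 'I_m => 0 < i)%N r',
      sprod r = wJ R J *m sprod r'
    & (lbits 0 m (ord_mem J) + size r' <= size r)%N].
  have [x [r' [r0 -> lr]]] := sprod_decomp r.
  rewrite -mulmxA sprod_ones// -wJ_wbits => /wJ_ones_inj xJ; exists r'.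
  rewrite xJ; split=> //; rewrite (eq_lbits (y := x))// => i /= im.
  by rewrite -xJ (ord_memE _ (Ordinal im)) inE.
have Jword : is_word (lbits 0 m (ord_mem J)) (wJ R J).
  by rewrite -[in wJ _ _](set_ord_mem J) wJ_wbits is_word_wbits.
have tcosJ : cosetA (sprod t) (wJ R J).
  have [t' [t'0 -> _]] := decJ t tJ.
  exists (sprod (rev t')); first by apply: WA_sprod; rewrite all_rev.
  by rewrite -mulmxA sprod_rev mulmx1.
(* A word this short leaves no room for a nonempty second factor. *)
have lenJ r : sprod r *m const_mx 1 = wJ R J *m const_mx 1 :> 'cV_m ->
    (size r <= lbits 0 m (ord_mem J))%N -> sprod r = wJ R J.
  move=> /decJ[[|i r'] [_ -> lr]] lr'; last by move: lr => /=; lia.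
  by rewrite /sprod big_nil mulmx1.
have cos_word v' : cosetA (sprod t) v' ->
    exists2 r, size r = len v' & v' = sprod r /\
      sprod r *m const_mx 1 = wJ R J *m const_mx 1 :> 'cV_m.
  move=> [_ /WAP[a a0 ->] <-]; rewrite -sprod_cat.
  have : is_word (size (t ++ a)) (sprod (t ++ a)).
    by apply/is_wordP; exists (t ++ a).
  move=> /is_word_len /is_wordP[r <- e]; exists r => //; split=> //.
  by rewrite -e sprod_cat -mulmxA sprod_ones.
(* [xget] makes an arbitrary choice, so uniqueness of the shortest element is needed as well as
   minimality. *)
apply: xget_unique => [|v' [v'cos v'min]].
  split=> [|v' v'cos]; first exact: tcosJ.
  have [r <- [_ /decJ[r' [_ _ lr]]]] := cos_word v' v'cos.
  by apply: leq_trans (len_min Jword) _; lia.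
have [r lr [-> rJ]] := cos_word v' v'cos.
apply: lenJ => //; rewrite lr.
exact: leq_trans (v'min _ tcosJ) (len_min Jword).
Qed.

Lemma wbits_ones m x :
  wbits m 0 m x *m const_mx 1 = colf m (fun k => (-1) ^+ x k).
Proof. by rewrite -wJ_wbits wJ_ones; apply/colP => k; rewrite !mxE inE. Qed.

(** * Embedding into rank n+1, the elements [calI], and bit insertion *)

Lemma emb1 n : emb 1%:M = 1%:M :> 'M[R]_n.+1.
Proof.
apply/matrixP => i j; rewrite !mxE.
case: unliftP => [i'|] ->; case: unliftP => [j'|] ->.
- by rewrite mxE (inj_eq lift_inj).
- by rewrite eq_sym (negPf (neq_lift _ _)).
- by rewrite (negPf (neq_lift _ _)).
- by rewrite eqxx.
Qed.

Lemma emb_w n j : (j <= n)%N -> emb (w R n j) = w R n.+1 j.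
Proof.
elim: j => [|j IH] jn; first by rewrite /w !big_nil emb1.
by rewrite (wS n) embM (IH (ltnW jn)) emb_s// (wS n.+1).
Qed.

Lemma emb_wbits n b x : (b <= n)%N ->
  emb (wbits n 0 b x) = wbits n.+1 0 b x.
Proof.
elim: b => [|b IH] bn; first by rewrite /wbits !big_geq ?emb1.
rewrite /wbits !big_nat_recr//= embM IH 1?ltnW//; congr (_ * _).
by case: (x b); rewrite ?expr1 ?emb_w// !expr0 emb1.
Qed.

Lemma emb_wJ n (J : {set 'I_n}) :
  emb (wJ R J) = wbits n.+1 0 n.+1 (ord_mem J).
Proof.
rewrite -{1}(set_ord_mem J) wJ_wbits emb_wbits// /wbits [RHS]big_nat_recr//=.
by rewrite ord_mem_ge// expr0 mulr1.
Qed.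

(** The last coordinate descends one position per factor; the leftmost, [s R n.+1 p.+2], makes the
    final move from p+1 to p. *)
Lemma up_col n p f : (p <= n)%N ->
  \prod_(p.+2 <= k < n.+2) s R n.+1 k *m colf n.+1 f =
  colf n.+1 (fun k => if (k < p)%N then f k else if k == p then f n else f k.-1).
Proof.
have [d] := ubnP (n - p); elim: d p => // d IH p dp pn.
have [np|{}pn] := leqP n p.
  have -> : p = n by lia.
  rewrite big_geq// mul1mx; apply/colP => -[k km]; rewrite !mxE /=; index_cases.
rewrite big_ltn; last lia.
rewrite -mulmxA IH; try lia.
rewrite s_col; last lia.
by apply/colP => -[k km]; rewrite !mxE /=; index_cases.
Qed.

Lemma is_word_up n p : exists k,
  is_word k (\prod_(p.+2 <= k < n.+2) s R n.+1 k).
Proof.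
have [d] := ubnP (n - p); elim: d p => // d IH p dp.
have [np|pn] := leqP n p; first by exists 0%N; rewrite big_geq ?is_word1.
have [|k ik] := IH p.+1; first lia.
exists (1 + k)%N; rewrite big_ltn; last lia.
by apply: is_wordM => //; apply: is_word_s; lia.
Qed.

Lemma nth_bits m (J : {set 'I_m}) k : nth false (bits J) k = ord_mem J k.
Proof.
have [km|mk] := ltnP k m; last first.
  by rewrite nth_default ?size_tuple ?ord_mem_ge.
rewrite -[k]/(val (Ordinal km)) -tnth_nth tnth_mktuple.
by rewrite -(ord_memE J (Ordinal km)).
Qed.

(** Insertion is phrased with the same tests as [up_col], so the two compare entry by entry. *)
Definition insert_nat i b (x : nat -> bool) (k : nat) : bool :=
  if (k < i)%N then x k else if k == i then b else x k.-1.

Lemma insert_bitsE n i b (J : {set 'I_n}) : (i <= n)%N ->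
  bits [set k : 'I_n.+1 | insert_nat i b (ord_mem J) k]%SET =
  insert_bit i b (bits J).
Proof.
move=> i_n; apply: eq_from_tnth => k; rewrite tnth_mktuple inE.
rewrite /insert_nat (tnth_nth false) /= nth_cat size_takel ?size_tuple ?card_ord//.
case: ltngtP => [ki|ik|->]; rewrite ?subnn//=.
  by rewrite nth_take// nth_bits.
rewrite -(subnSK ik) /= nth_drop nth_bits; congr ord_mem; lia.
Qed.

Lemma FinvE m (J : {set 'I_m}) : Finv R (bits J) = wJ R J.
Proof.
rewrite -(F_wJ R) /Finv pinvKV ?inE//; last by exists J.
by case: (F_bij R m).
Qed.

(** This is the case b = 0; at i = n the identity appears as the empty product. *)
Lemma calI_sub n i : (i <= n)%N ->
  calI R n (n - i) = \prod_(i.+2 <= k < n.+2) s R n.+1 k.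
Proof.
move=> i_n; rewrite /calI leq_subr addn2 -addn2.
case: eqP => [ni|_]; first by rewrite big_geq//; lia.
by congr (\prod_(_ <= k < _) _); lia.
Qed.

(** This is the case b = 1. *)
Lemma calI_add n i :
  calI R n (n.+1 + i) = w R n.+1 i.+1 *m \prod_(2 <= k < n.+2) s R n.+1 k.
Proof.
rewrite /calI addSn /= ltnNge leq_addr /= !addn2 subSn ?leq_addr// addKn.
by congr (_ *m \prod_(_ <= k < _) _); lia.
Qed.

End Words.

Theorem theorem4p4 (R : realType) (n : nat) (n_ge2 : (2 <= n)%N)
    (i : nat) (i_le_n : (i <= n)%N) (b : bool) (i' : nat)
    (i'E : i'%:Z = n%:Z + (nat_of_bool b)%:Z + (-1) ^+ b.+1 * i%:Z)
    (u : 'M[R]_n) (Mu : MM R n u) :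
  act (calI R n i') (emb u) = (@Finv R n.+1 \o @insert_bit n i b \o @F R n) u.
Proof.
case: Mu => J ->; rewrite /= F_wJ -insert_bitsE// FinvE.
have [l wu] : exists l, is_word l (emb (wJ R J)).
  by exists (lbits 0 n.+1 (ord_mem J)); rewrite emb_wJ is_word_wbits.
(* Both cases involve the product of [up_col], with p = 0 for b = 1 and p = i for b = 0. *)
have [calIE [k wI]] : calI R n i' = (if b then w R n.+1 i.+1 else 1%:M) *m
    (\prod_((if b then 0 else i).+2 <= k < n.+2) s R n.+1 k) /\
    exists k, is_word k (calI R n i').
  have [k wup] := is_word_up (R := R) n (if b then 0%N else i).
  case: b i'E wup => i'E wup.
    have -> : i' = (n.+1 + i)%N by move: i'E; rewrite sqrrN expr1n mul1r; lia.
    rewrite calI_add; split=> //; exists (i.+1 + k)%N.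
    by apply: is_wordM => //; apply: is_word_w.
  have -> : i' = (n - i)%N by move: i'E; rewrite expr1 mulN1r; lia.
  by rewrite calI_sub// mul1mx; split=> //; exists k.
apply: (act_wJ (is_wordM wI wu)).
rewrite (wJ_wbits _ (insert_nat i b (ord_mem J))) wbits_ones -mulmxA emb_wJ.
rewrite wbits_ones calIE -mulmxA up_col; last first.
  by case: b {i'E calIE}.
case: b {i'E calIE} => /=.
  rewrite w_col//; apply/colP => -[j jn]; rewrite !mxE /insert_nat /=; index_cases.
  (* Only position i remains: it holds the negated last coordinate, which was 1 because [ord_mem J]
     is false at n. *)
  by rewrite ord_mem_ge.
rewrite mul1mx; apply/colP => -[j jn]; rewrite !mxE /insert_nat /=; index_cases.
by rewrite ord_mem_ge.
Qed.
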